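(* Let $G=(V,E)$ be a finite weighted graph with vertex measure $\mu$, $k\in\mathbb{N}$, and $s$ an $S^1_k$-valued signature such that the Cheeger constant $h=h_1^s(\mu)$ is positive. Then for every $f:V\to\mathbb{C}$, $$\sum_{u\in V}|f(u)|\mu(u)\le\frac3h\sum_{\{u,v\}\in E}w_{uv}|f(u)-s_{uv}f(v)|.$$
   Context: $G=(V,E)$ undirected simple finite, edge weights $w_{uv}=w_{vu}>0$, $\mu:V\to(0,\infty)$; $|E(X,X^c)|=\sum_{u\in X,v\notin X}w_{uv}$, $\mathrm{vol}_\mu(X)=\sum_{u\in X}\mu(u)$. $S^1_k=\{e^{2\pi ij/k}:j=1,\dots,k\}$; a signature is $s:E^{or}\to S^1_k$ with $s_{vu}=s_{uv}^{-1}$. For nonempty $V_1$ with induced edges $E_1$, $\iota^s(V_1)=\min_{\tau:V_1\to S^1_k}\sum_{\{u,v\}\in E_1}w_{uv}|\tau(u)-s_{uv}\tau(v)|$. The Cheeger constant is $h_1^s(\mu)=\min_{\emptyset\ne V_1\subseteq V}\frac{\iota^s(V_1)+|E(V_1,V_1^c)|}{\mathrm{vol}_\mu(V_1)}$. *)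

(* Defs.v *)
From mathcomp Require Import all_boot all_order all_algebra.
From mathcomp Require Import complex.
From mathcomp Require Import all_classical all_reals all_analysis.

Set Implicit Arguments.
Unset Strict Implicit.
Unset Printing Implicit Defensive.

Import Order.TTheory GRing.Theory Num.Theory.

Local Open Scope ring_scope.
Local Open Scope complex_scope.

(* The norm of [R[i]] from the numClosedField structure is [R[i]]-valued; this
   is the [R]-valued modulus. *)
Notation cmod := ComplexField.Normc.normc.

Definition expi {R : realType} (t : R) : R[i] := cos t +i* sin t.

Definition rootsS1 {R : realType} (k : nat) : set R[i] :=
  [set z | exists2 j : nat, (1 <= j <= k)%N & z = expi (2 * pi * j%:R / k%:R)].

Definition is_signature {R : realType} {V : finType} (e : rel V) (k : nat)
    (s : V -> V -> R[i]) : Prop :=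
  forall u v, e u v -> rootsS1 k (s u v) /\ s v u = (s u v)^-1.

(* Sum over the unordered edges of the subgraph induced by [X], for a summand
   [F] that is symmetric on edges: every edge appears twice among the ordered
   adjacent pairs, hence the factor 1/2 (see [edge_sum_orient]). *)
Definition edge_sum {R : realType} {V : finType} (e : rel V) (X : {set V})
    (F : V -> V -> R) : R :=
  2^-1 * \sum_(u in X) \sum_(v in X | e u v) F u v.

Definition edge_boundary {R : realType} {V : finType} (e : rel V) (w : V -> V -> R)
    (X : {set V}) : R :=
  \sum_(u in X) \sum_(v in ~: X | e u v) w u v.

Definition vol_mu {R : realType} {V : finType} (mu : V -> R) (X : {set V}) : R :=
  \sum_(u in X) mu u.

Definition signed_variation {R : realType} {V : finType} (e : rel V)
    (w : V -> V -> R)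
    (s : V -> V -> R[i]) (X : {set V}) (f : V -> R[i]) : R :=
  edge_sum e X (fun u v => w u v * cmod (f u - s u v * f v)).

(* [tau] is a function on [X]: its values outside [X] are irrelevant.  The
   infimum is a minimum (see [frustration_min]). *)
Definition frustration {R : realType} {V : finType} (e : rel V)
    (w : V -> V -> R) (k : nat) (s : V -> V -> R[i]) (X : {set V}) : R :=
  inf [set signed_variation e w s X tau | tau in
        [set tau : V -> R[i] | forall u, u \in X -> rootsS1 k (tau u)]].

(* The infimum is a minimum when [V] is nonempty (see [cheeger_min]); when [V]
   is empty it is [inf set0 = 0]. *)
Definition cheeger {R : realType} {V : finType} (e : rel V) (w : V -> V -> R)
    (mu : V -> R) (k : nat) (s : V -> V -> R[i]) : R :=
  inf [set (frustration e w k s X + edge_boundary e w X) / vol_mu mu X | X in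
        [set X : {set V} | X != finset.set0]].

Lemma edge_sum_orient {R : realType} {V : finType} (e : rel V) (X : {set V})
    (F : V -> V -> R) (o : rel V) :
  symmetric e -> (forall u v, e u v -> F u v = F v u) ->
  (forall u v, e u v -> o v u = ~~ o u v) ->
  edge_sum e X F = \sum_(u in X) \sum_(v in X | e u v && o u v) F u v.
Proof.
move=> esym Fsym oP; rewrite /edge_sum.
set S := (RHS).
have -> : \sum_(u in X) \sum_(v in X | e u v) F u v = S + S.
  transitivity (S + \sum_(u in X) \sum_(v in X | e u v && ~~ o u v) F u v).
    rewrite -big_split /=; apply: eq_bigr => u uX.
    rewrite (bigID (o u)) /=; congr (_ + _);
      by apply: eq_bigl => v; rewrite andbA.
  congr (_ + _); rewrite (exchange_big_dep (mem X)) /=; last first.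
    by move=> u v _ /andP[].
  apply: eq_bigr => v vX; rewrite [RHS]big_mkcond [LHS]big_mkcond /=.
  apply: eq_bigr => u _; rewrite vX /= (esym v u).
  case: (u \in X) => //=; case euv: (e u v) => //=.
  by rewrite (oP _ _ euv); case: ifP => // _; exact: Fsym.
by rewrite -mulr2n -[S *+ 2]mulr_natl mulrA mulVf ?mul1r// pnatr_eq0.
Qed.

Lemma inf_attained {R : realType} (A : set R) (x : R) :
  A x -> lbound A x -> inf A = x.
Proof.
move=> Ax lx; apply/eqP; rewrite eq_le; apply/andP; split.
  by apply: ge_inf => //; exists x.
by apply: lb_le_inf => //; exists x.
Qed.

Lemma frustration_min {R : realType} {V : finType} (e : rel V)
    (w : V -> V -> R) (k : nat) (s : V -> V -> R[i]) (X : {set V}) :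
  (0 < k)%N ->
  exists tau : V -> R[i], [/\ forall u, u \in X -> rootsS1 k (tau u),
    frustration e w k s X = signed_variation e w s X tau &
    forall tau', (forall u, u \in X -> rootsS1 k (tau' u)) ->
      signed_variation e w s X tau <= signed_variation e w s X tau'].
Proof.
case: k => // k _.
pose z (j : 'I_k.+1) : R[i] := expi (2 * pi * j.+1%:R / k.+1%:R).
have zS j : rootsS1 k.+1 (z j) by exists j.+1 => //=; exact: ltn_ord.
pose t (g : {ffun V -> 'I_k.+1}) u := z (g u).
pose g0 : {ffun V -> 'I_k.+1} := [ffun=> ord0].
case: (@Order.TotalTheory.arg_minP _ _ _ g0 xpredT
  (fun g => signed_variation e w s X (t g)) isT) => g _ gmin.
have le_g tau' : (forall u, u \in X -> rootsS1 k.+1 (tau' u)) ->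
    signed_variation e w s X (t g) <= signed_variation e w s X tau'.
  move=> tauS.
  have [h hP] : exists h : V -> 'I_k.+1, forall u, u \in X -> tau' u = z (h u).
    suff /choice[h hP] : forall u, exists j, u \in X -> tau' u = z j by exists h.
    move=> u.
    have [uX|] := boolP (u \in X); last by exists ord0.
    have [[//|j] /= jk ->] := tauS u uX.
    by exists (Ordinal (jk : (j < k.+1)%N)).
  apply: le_trans (gmin (finfun h) isT) _; rewrite le_eqVlt; apply/orP; left.
  apply/eqP; congr (_ * _); apply: eq_bigr => u uX; apply: eq_bigr => v.
  by case/andP=> vX _; rewrite /t !ffunE !hP.
exists (t g); split => //; first by move=> u _; exact: zS.
apply: inf_attained; first by exists (t g) => //= u _; exact: zS.
by move=> _ [tau' tauS <-]; exact: le_g.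
Qed.

Lemma cheeger_min {R : realType} {V : finType} (e : rel V) (w : V -> V -> R)
    (mu : V -> R) (k : nat) (s : V -> V -> R[i]) :
  (0 < #|V|)%N ->
  let q X := (frustration e w k s X + edge_boundary e w X) / vol_mu mu X in
  exists X : {set V}, [/\ X != finset.set0, cheeger e w mu k s = q X &
    forall Y : {set V}, Y != finset.set0 -> q X <= q Y].
Proof.
move=> V0 q.
have T0 : finset.setT != finset.set0 :> {set V}.
  by rewrite -card_gt0 cardsT.
case: (@Order.TotalTheory.arg_minP _ _ _ (finset.setT : {set V})
  (fun X => X != finset.set0) q T0) => X X0 Xmin.
exists X; split => //; apply: inf_attained; first by exists X.
by move=> _ [Y Y0 <-]; exact: Xmin.
Qed.

(* Main.v *)
Require Import Defs.
From mathcomp Require Import all_boot all_order all_algebra.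
From mathcomp Require Import complex ring lra.
From mathcomp Require Import all_classical all_reals all_analysis.

Import Order.TTheory GRing.Theory Num.Theory.
Import numFieldNormedType.Exports.

Local Open Scope ring_scope.
Local Open Scope complex_scope.

(* Fix angles [al] with f = |f| exp(i al).  Rounding [al] to a multiple of
   2 pi / k gives an S^1_k-valued [tau], and the definition of the Cheeger
   constant bounds h vol(X) by the signed variation of [tau] on X plus the
   boundary of X, for every X.  Summing over the superlevel sets X of |f| gives

     h sum_u |f u| mu u <=
       sum_uv w_uv (min(|f u|, |f v|) |tau u - s_uv tau v| + | |f u| - |f v| |).

   Averaging over rotations of the rounding grid replaces |tau u - s_uv tau v|
   by at most the angle between f u and s_uv f v, and min(|f u|, |f v|) times
   this angle is at most 2 |f u - s_uv f v|; the last term is at most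
   |f u - s_uv f v|, whence the constant 3.  The average is taken over [N]
   equally spaced rotations, with an error O(1/N), and N tends to infinity. *)

(** * Two-sided bounds on the sine from the mean value theorem *)

Lemma sin_MVT (R : realType) (x : R) :
  0 <= x -> exists2 c : R, c \in `[0, x] & sin x = cos c * x.
Proof.
move=> x0.
have cs : {within `[0, x], continuous (@sin R)}%classic.
  by apply: continuous_subspaceT => y; exact: continuous_sin.
have [c cx] := @MVT_segment R sin cos 0 x x0 (fun y _ => is_derive_sin y) cs.
by rewrite sin0 !subr0 => E; exists c.
Qed.

Lemma abs_sin_le (R : realType) (x : R) : `|sin x| <= `|x|.
Proof.
wlog x0 : x / 0 <= x.
  move=> H; have [x0|/ltW x0] := leP 0 x; first exact: H.
  by rewrite -normrN -sinN -(normrN x) H // oppr_ge0.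
have [c _ ->] := sin_MVT R x x0.
by rewrite normrM ler_piMl // cos_max.
Qed.

(* With [t = x / 2], [sin x = 2 sin t cos t >= 2 t (cos t)^2 = t (1 + cos x)]. *)
Lemma sin_ge_half (R : realType) (x : R) :
  0 <= x <= pi / 2 -> x / 2 <= sin x.
Proof.
move=> /andP[x0 xpi]; pose t : R := x / 2.
have pi0 := @pi_gt0 R.
have [c] := sin_MVT R t ltac:(rewrite /t; lra).
rewrite in_itv /= => /andP[c0 ct] E.
have ct' : cos t <= cos c.
  have [->//|ne] := eqVneq c t.
  apply: ltW; rewrite ltr_cos ?in_itv /= ?lt_neqAle ?ne ?ct //.
  - by apply/andP; split; rewrite /t in ct *; lra.
  - by apply/andP; split; rewrite /t in ct *; lra.
have t0 : 0 <= cos t by apply: cos_ge0_pihalf; rewrite /t; apply/andP; split; lra.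
have cx : 0 <= cos x by apply: cos_ge0_pihalf; apply/andP; split; lra.
have xE : x = t *+ 2 by rewrite /t; lra.
have := cos_mulr2n t; rewrite -xE => cxE.
rewrite [in X in _ <= X]xE sin_mulr2n E.
have h : cos t * cos t * t <= cos t * cos c * t.
  by rewrite ler_wpM2r ?ler_wpM2l // /t; lra.
have h2 : t <= cos t * cos t * t *+ 2.
  have -> : cos t * cos t * t *+ 2 = (cos x + 1) * t by rewrite cxE; ring.
  by rewrite ler_peMl /t //; lra.
rewrite mulrA; move: h h2; rewrite /t; lra.
Qed.

(** * Polar form, and distances between points given in polar form *)

Lemma cmod_ge0 (R : realType) (z : R[i]) : 0 <= cmod z.
Proof. by case: z => a b /=; exact: sqrtr_ge0. Qed.

Lemma expiD (R : realType) (a b : R) : expi (a + b) = expi a * expi b.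
Proof. by rewrite /expi cosD sinD; congr (_ +i* _); ring. Qed.

Lemma expi_int (R : realType) (m : int) : expi (2 * pi * m%:~R : R) = 1.
Proof.
have n1 (n : nat) : expi (2 * pi * n%:R : R) = 1.
  have -> : 2 * pi * n%:R = 0 + (pi *+ 2) *+ n :> R by ring.
  rewrite /expi (periodicn (@cosD2pi R)) (periodicn (@sinD2pi R)).
  by rewrite cos0 sin0.
case: m => n; first exact: n1.
rewrite NegzE; apply: (mulIr (unitr1 _)); rewrite -{1}(n1 n.+1) -expiD.
by rewrite -mulrDr mulrNz addNr mulr0 /expi cos0 sin0 mulr1.
Qed.

(** For modulus [r != 0] the angle is [acos (x / r)], negated when [y < 0]; at the origin the angle
    [0] is chosen. *)
Lemma polar_form (R : realType) (z : R[i]) :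
  exists a : R, z = (cmod z)%:C * expi a.
Proof.
case: z => x y; set r := cmod _.
have r0 : 0 <= r := cmod_ge0 R _.
have rE : r ^+ 2 = x ^+ 2 + y ^+ 2 by rewrite sqr_sqrtr ?addr_ge0 ?sqr_ge0.
have [r00|rn0] := eqVneq r 0.
  by exists 0; rewrite r00 mul0r; exact: (@ComplexField.Normc.eq0_normc _ (x +i* y)).
have x1 : -1 <= x / r <= 1.
  rewrite -ler_norml normrM normfV (ger0_norm r0) ler_pdivrMr ?lt0r ?rn0 // mul1r.
  by rewrite -ler_sqr ?nnegrE // real_normK ?num_real // rE lerDl sqr_ge0.
have yE : Num.sqrt (1 - (x / r) ^+ 2) = `|y| / r.
  rewrite -[RHS]ger0_norm ?divr_ge0 // -[RHS]sqrtr_sqr; congr (Num.sqrt _).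
  rewrite !exprMn !exprVn rE real_normK ?num_real //.
  by field; rewrite -rE sqrf_eq0.
have [y0|y0] := leP 0 y.
- exists (acos (x / r)); rewrite /expi acosK // sin_acos // yE ger0_norm //.
  by apply/eqP; rewrite eq_complex /=; apply/andP; split; apply/eqP; field.
- exists (- acos (x / r)); rewrite /expi cosN sinN acosK // sin_acos // yE ltr0_norm //.
  by apply/eqP; rewrite eq_complex /=; apply/andP; split; apply/eqP; field.
Qed.

(** Law of cosines, with [1 - cos d = 2 sin (d / 2) ^ 2] used to separate a radial from an angular
    term. Each of the next three bounds is read off from these two terms. *)
Lemma sqr_cmod_polar_sub (R : realType) (p q a b : R) :
  cmod (p%:C * expi a - q%:C * expi b) ^+ 2 =
  (p - q) ^+ 2 + p * q * 4 * sin ((a - b) / 2) ^+ 2.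
Proof.
have -> : sin ((a - b) / 2) ^+ 2 = (1 - cos (a - b)) / 2.
  rewrite -[in RHS](mulfVK (x := 2) _ (a - b)) ?pnatr_eq0 // mulr_natr.
  by rewrite cos_mulr2n cos2sin2; field.
rewrite /= sqr_sqrtr ?addr_ge0 ?sqr_ge0 // cosB.
have := cos2Dsin2 a; have := cos2Dsin2 b; move: (cos a) (sin a) (cos b) (sin b).
move=> ca sa cb sb hb ha.
transitivity (p ^+ 2 * (ca ^+ 2 + sa ^+ 2) + q ^+ 2 * (cb ^+ 2 + sb ^+ 2)
  - 2 * p * q * (ca * cb + sa * sb)); first by ring.
by rewrite ha hb; field.
Qed.

Lemma cmod_expi_sub_le (R : realType) (a b : R) :
  cmod (expi a - expi b) <= `|a - b|.
Proof.
rewrite -ler_sqr ?nnegrE ?cmod_ge0 //.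
have -> : expi a - expi b = 1%:C * expi a - 1%:C * expi b by rewrite !mul1r.
rewrite sqr_cmod_polar_sub subrr expr0n add0r !mul1r.
have h : sin ((a - b) / 2) ^+ 2 <= ((a - b) / 2) ^+ 2.
  rewrite -[leLHS]real_normK ?num_real // -[leRHS]real_normK ?num_real //.
  by rewrite ler_sqr ?nnegrE // abs_sin_le.
have -> : `|a - b| ^+ 2 = 4 * ((a - b) / 2) ^+ 2.
  by rewrite real_normK ?num_real //; field.
by rewrite ler_wpM2l.
Qed.

Lemma abs_sub_le_cmod_polar (R : realType) (p q a b : R) :
  0 <= p -> 0 <= q -> `|p - q| <= cmod (p%:C * expi a - q%:C * expi b).
Proof.
move=> p0 q0; rewrite -ler_sqr ?nnegrE ?cmod_ge0 // sqr_cmod_polar_sub.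
by rewrite real_normK ?num_real // lerDl mulr_ge0 ?sqr_ge0 // !mulr_ge0.
Qed.

(** Since [|a - b| / 2] is at most [pi / 2], [sin_ge_half] gives
    [|a - b| ^ 2 <= 16 sin ((a - b) / 2) ^ 2]. With [min p q ^ 2 <= p q], the left side squared is
    at most 4 times the angular term, whence the factor 2. *)
Lemma min_angle_le_cmod_polar (R : realType) (p q a b : R) :
  0 <= p -> 0 <= q -> `|a - b| <= pi ->
  Num.min p q * `|a - b| <= 2 * cmod (p%:C * expi a - q%:C * expi b).
Proof.
move=> p0 q0 abpi; set m := Num.min p q.
have m0 : 0 <= m by rewrite le_min p0.
rewrite -ler_sqr ?nnegrE ?mulr_ge0 ?cmod_ge0 // !exprMn sqr_cmod_polar_sub.
have mpq : m ^+ 2 <= p * q by rewrite expr2 ler_pM // ge_min lexx ?orbT.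
have hs : `|a - b| / 2 / 2 <= `|sin ((a - b) / 2)|.
  have := sin_ge_half R (`|a - b| / 2).
  have -> : `|sin ((a - b) / 2)| = sin (`|a - b| / 2).
    rewrite -[in RHS](ger0_norm (ler0n R 2)) -normfV -normrM.
    have [d0|/ltW d0] := leP 0 ((a - b) / 2).
      rewrite (ger0_norm d0) ger0_norm // sin_ge0_pi // d0.
      by have := ler_norm (a - b); have := @pi_gt0 R; lra.
    rewrite (ler0_norm d0) sinN ler0_norm // -oppr_ge0 -sinN.
    rewrite sin_ge0_pi // oppr_ge0 d0.
    by have := ler_norm (- (a - b)); rewrite normrN; have := @pi_gt0 R; lra.
  by apply; rewrite divr_ge0 //=; lra.
have {}hs : `|a - b| ^+ 2 <= 16 * sin ((a - b) / 2) ^+ 2.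
  rewrite -(real_normK (num_real (sin _))).
  have -> : 16 * `|sin ((a - b) / 2)| ^+ 2 = (4 * `|sin ((a - b) / 2)|) ^+ 2 by ring.
  by rewrite ler_sqr ?nnegrE ?mulr_ge0 //; lra.
apply: le_trans (_ : p * q * (16 * sin ((a - b) / 2) ^+ 2) <= _).
  by rewrite ler_pM ?sqr_ge0.
by have := sqr_ge0 (p - q); lra.
Qed.

(** * Roots of unity with integer exponents, and sums of integer quotients *)

Lemma rootsS1_int (R : realType) (k : nat) (m : int) :
  (0 < k)%N -> rootsS1 k (expi (2 * pi * m%:~R / k%:R : R)).
Proof.
move=> k0; have kn0 : k%:R != 0 :> R by rewrite pnatr_eq0 -lt0n.
have kz : 0 < k%:Z by [].
have [j jk mE] : exists2 j : nat, (1 <= j <= k)%N &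
    exists q : int, m = q * k%:Z + j%:Z.
  have := divz_eq m k%:Z; have := modz_ge0 m (lt0r_neq0 kz); have := ltz_pmod m kz.
  case: (m %% k%:Z)%Z => // -[|j] jk _ mE.
    (* The exponents of [rootsS1] run over [1..k], so residue 0 is represented by [k], with the
       quotient lowered by one. *)
    by exists k; [rewrite k0 leqnn|exists ((m %/ k%:Z)%Z - 1); rewrite [LHS]mE; ring].
  by exists j.+1; [rewrite /= ltnW|exists (m %/ k%:Z)%Z].
case: mE => q ->; exists j => //.
have -> : 2 * pi * (q * k%:Z + j%:Z)%:~R / k%:R =
    2 * pi * q%:~R + 2 * pi * j%:R / k%:R :> R.
  by rewrite intrD intrM; field.
by rewrite expiD expi_int mul1r.
Qed.

(** Raising [n] by one slides the window of [N] consecutive numerators: the quotient of [n] leaves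
    and that of [n + N], which is one larger, enters. *)
Lemma sum_divz_addn (N p : nat) (n : int) : (0 < N)%N ->
  \sum_(j < N) ((n + p%:Z + j%:Z) %/ N%:Z)%Z =
  \sum_(j < N) ((n + j%:Z) %/ N%:Z)%Z + p%:Z.
Proof.
case: N => // N _; elim: p n => [|p IH] n.
  by rewrite !addr0.
have -> : n + p.+1%:Z = (n + 1) + p%:Z by rewrite -addn1 PoszD; ring.
rewrite IH big_ord_recr [in RHS]big_ord_recl /=.
have -> : n + 1 + N%:Z = 1 * N.+1%:Z + n by rewrite -addn1 PoszD; ring.
rewrite divzMDl // addr0 -addn1 PoszD.
under [X in _ = _ + X + _]eq_bigr => j _ do
  rewrite /bump /= add1n -addn1 PoszD [j%:Z + _]addrC addrA.
by ring.
Qed.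

(** Quotients are monotone, so all differences have the same sign and the absolute values can be
    taken outside the sum. This is the exact, discrete form of averaging over rotations of the
    grid. *)
Lemma sum_abs_divz_sub (N : nat) (m n : int) : (0 < N)%N ->
  \sum_(j < N) `|((m + j%:Z) %/ N%:Z)%Z - ((n + j%:Z) %/ N%:Z)%Z| = `|m - n|.
Proof.
move=> N0.
wlog nm : m n / n <= m.
  move=> H; have [|/ltW nm] := leP n m; first exact: H.
  by rewrite distrC -(H _ _ nm); apply: eq_bigr => j _; rewrite distrC.
have mE : m = n + `|m - n|%N%:Z by rewrite gez0_abs ?subr_ge0 //; ring.
rewrite (eq_bigr (fun j : 'I_N => ((m + j%:Z) %/ N%:Z)%Z - ((n + j%:Z) %/ N%:Z)%Z)).
  by rewrite sumrB {1}mE sum_divz_addn // addrAC subrr add0r abszE.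
by move=> j _; rewrite ger0_norm // subr_ge0 lez_pdiv2r // lerD2r.
Qed.

(** * Rounding of angles *)

(** The unit is [2 pi / (k N)], a grid [N] times finer than that of the [k]-th roots of unity, so
    that the [N] rotations become integer offsets. *)
Definition angle_floor {R : realType} (k N : nat) (a : R) : int :=
  Num.floor (N%:R * k%:R * a / (2 * pi)).

(* The angle [a] rounded to a multiple of [2 pi / k], after a rotation by
   [j / N] of that step. *)
Definition rounded_root {R : realType} (k N : nat) (n : int) (j : nat) : R[i] :=
  expi (2 * pi * ((n + j%:Z) %/ N%:Z)%Z%:~R / k%:R).

(** With [rounded_root_shift]: rounding commutes with multiplication by a [k]-th root of unity, so a
    signature value can be absorbed into the angle. *)
Lemma angle_floor_shift (R : realType) (k N : nat) (a : R) (q : int) :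
  (0 < k)%N ->
  angle_floor k N (a + 2 * pi * q%:~R / k%:R) = angle_floor k N a + q * N%:Z.
Proof.
move=> k0; rewrite /angle_floor.
have -> : N%:R * k%:R * (a + 2 * pi * q%:~R / k%:R) / (2 * pi) =
    N%:R * k%:R * a / (2 * pi) + (q * N%:Z)%:~R :> R.
  have pi0 : @pi R != 0 by rewrite gt_eqF // pi_gt0.
  rewrite intrM; move: (@pi R) pi0 => c c0.
  by field; rewrite c0 pnatr_eq0 -lt0n k0.
by rewrite floorDrz ?rpred_int // intrKfloor.
Qed.

Lemma rounded_root_shift (R : realType) (k N j : nat) (n q : int) :
  (0 < N)%N ->
  rounded_root k N (n + q * N%:Z) j =
  expi (2 * pi * q%:~R / k%:R) * rounded_root k N n j :> R[i].
Proof.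
move=> N0; rewrite /rounded_root -expiD.
have -> : n + q * N%:Z + j%:Z = q * N%:Z + (n + j%:Z) by ring.
by rewrite divzMDl ?eqz_nat -?lt0n // intrD; congr expi; ring.
Qed.

(** The witness is [(a - b) / (2 pi)] rounded to a nearest integer, which leaves at most half a
    turn. *)
Lemma nearest_angle (R : realType) (a b : R) :
  exists m : int, `|a - (b + 2 * pi * m%:~R)| <= pi.
Proof.
have pi0 := @pi_gt0 R.
pose x : R := (a - b) / (2 * pi) + 1 / 2; exists (Num.floor x).
have /andP[h1 h2] := floor_itv x; move: h1 h2; rewrite intrD.
move: (Num.floor x)%:~R => m; rewrite /x => h1 h2.
have abE : a - b = (a - b) / (2 * pi) * (2 * pi).
  by rewrite divfK // gt_eqF // mulr_gt0.
move: abE h1 h2; move: (_ / (2 * pi)) => y abE h1 h2.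
have -> : a - (b + 2 * pi * m) = (a - b) - 2 * pi * m by ring.
rewrite abE ler_norml; apply/andP; split; nra.
Qed.

(** * Edge sums, the layer-cake inequality and the averaged bound on one edge *)

Lemma edge_sum_le {R : realType} {V : finType} (e : rel V) (X : {set V})
    (F G : V -> V -> R) :
  (forall u v, e u v -> F u v <= G u v) -> edge_sum e X F <= edge_sum e X G.
Proof.
move=> FG; rewrite ler_wpM2l ?invr_ge0 //.
by apply: ler_sum => u _; apply: ler_sum => v /andP[_ /FG].
Qed.

Lemma edge_sumD {R : realType} {V : finType} (e : rel V) (X : {set V})
    (F G : V -> V -> R) :
  edge_sum e X (fun u v => F u v + G u v) = edge_sum e X F + edge_sum e X G.
Proof.
rewrite -mulrDr -big_split; congr (_ * _); apply: eq_bigr => u _.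
by rewrite -big_split.
Qed.

Lemma edge_sumZ {R : realType} {V : finType} (e : rel V) (X : {set V})
    (c : R) (F : V -> V -> R) :
  edge_sum e X (fun u v => c * F u v) = c * edge_sum e X F.
Proof.
rewrite [RHS]mulrCA [X in _ = _ * X]mulr_sumr; congr (_ * _).
by apply: eq_bigr => u _; rewrite mulr_sumr.
Qed.

Lemma eq_edge_sum {R : realType} {V : finType} (e : rel V) (X : {set V})
    (F G : V -> V -> R) :
  (forall u v, e u v -> F u v = G u v) -> edge_sum e X F = edge_sum e X G.
Proof.
move=> FG; congr (_ * _); apply: eq_bigr => u _; apply: eq_bigr => v /andP[_].
exact: FG.
Qed.

Lemma edge_sum_sum {R : realType} {V : finType} (e : rel V) (X : {set V})
    (N : nat) (F : 'I_N -> V -> V -> R) :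
  edge_sum e X (fun u v => \sum_(j < N) F j u v) = \sum_(j < N) edge_sum e X (F j).
Proof.
rewrite -mulr_sumr; congr (_ * _); rewrite exchange_big; apply: eq_bigr => u _ /=.
by rewrite exchange_big.
Qed.

(** An edge with exactly one end in [X] is met in both orders, which cancels the [1/2] of [edge_sum]
    and gives the boundary once. This evaluates a single layer in [layer_cake]. *)
Lemma edge_sum_indicator {R : realType} {V : finType} (e : rel V)
    (w a : V -> V -> R) (X : {set V}) :
  symmetric e -> (forall u v, e u v -> w u v = w v u) ->
  edge_sum e [set: V]%SET (fun u v => ((u \in X) && (v \in X))%:R * a u v
     + ((u \in X) (+) (v \in X))%:R * w u v) =
  edge_sum e X a + edge_boundary e w X.
Proof.
move=> esym wsym; rewrite edge_sumD; congr (_ + _).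
  congr (_ * _); rewrite [RHS]big_mkcond /=; apply: eq_big => [u|u _].
    by rewrite inE.
  case: ifP => uX; last by rewrite big1 // => v _; rewrite mul0r.
  rewrite [LHS]big_mkcond [RHS]big_mkcond; apply: eq_bigr => v _; rewrite inE /=.
  by case: (v \in X); case: (e u v); rewrite ?mul1r ?mul0r.
pose B := \sum_(u : V) \sum_(v : V | e u v) ((u \in X) && (v \notin X))%:R * w u v.
have BE : edge_boundary e w X = B.
  rewrite /edge_boundary big_mkcond; apply: eq_bigr => u _.
  case: ifP => uX; last by rewrite big1 // => v _; rewrite mul0r.
  rewrite big_mkcond [RHS]big_mkcond; apply: eq_bigr => v _; rewrite inE /=.
  by case: (v \in X); case: (e u v); rewrite ?mul1r ?mul0r.
have BE' : B = \sum_(u : V) \sum_(v : V | e u v) ((v \in X) && (u \notin X))%:R * w u v.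
  rewrite [RHS](exchange_big_dep xpredT) //=; apply: eq_bigr => u _.
  by apply: eq_big => [v|v /wsym ->]; first exact: esym.
rewrite BE /edge_sum; apply: (canLR (mulKf _)); rewrite ?pnatr_eq0 // mulr_natl mulr2n.
rewrite {2}BE' -big_split; apply: eq_big => [u|u _]; first by rewrite inE.
rewrite -big_split; apply: eq_big => [v|v _ /=]; first by rewrite inE.
by rewrite -mulrDl; case: (u \in X); case: (v \in X); rewrite /= ?addr0 ?add0r.
Qed.

(* Layer-cake argument: subtract the least positive value of [r] on its support
   [X], where the hypothesis applies, and recurse on the size of the support. *)
Lemma layer_cake {R : realType} {V : finType} (e : rel V)
    (w a : V -> V -> R) (nu : V -> R) (r : V -> R) :
  symmetric e -> (forall u v, e u v -> w u v = w v u) ->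
  (forall X, vol_mu nu X <= edge_sum e X a + edge_boundary e w X) ->
  (forall u, 0 <= r u) ->
  \sum_u r u * nu u <=
    edge_sum e [set: V]%SET (fun u v => Num.min (r u) (r v) * a u v + `|r u - r v| * w u v).
Proof.
move=> esym wsym volP.
have [n] := ubnP #|[set u | r u != 0]%SET|; elim: n r => // n IH r le_n r0.
have [E|[u0 u0X]] := finset.set_0Vmem [set u | r u != 0]%SET.
  have {}r0 u : r u = 0 by apply/eqP; apply: contraFT (finset.in_set0 u); rewrite -E inE.
  rewrite big1 => [|u _]; last by rewrite r0 mul0r.
  rewrite /edge_sum big1 ?mulr0 // => u _; rewrite big1 // => v _.
  by rewrite !r0 minxx subrr normr0 !mul0r addr0.
set X := [set u | r u != 0]%SET in u0X le_n.
have XP u : u \in X = (r u != 0) by rewrite inE.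
case: (@Order.TotalTheory.arg_minP _ _ _ u0 (mem X) r u0X) => m /= mX mmin.
pose r' u := r u - (u \in X)%:R * r m.
have rE u : r u = (u \in X)%:R * r m + r' u by rewrite /r' addrC subrK.
have r'0 u : 0 <= r' u.
  rewrite /r' subr_ge0; case: (boolP (u \in X)) => uX; last by rewrite mul0r.
  by rewrite mul1r; exact: mmin.
have r'out u : u \notin X -> r' u = 0.
  by move=> uX; rewrite /r' (negbTE uX) mul0r subr0; move: uX; rewrite XP negbK => /eqP.
have {}IH := IH r' _ r'0.
have rm0 : 0 <= r m by [].
rewrite (eq_bigr (fun u => r m * ((u \in X)%:R * nu u) + r' u * nu u)); last first.
  by move=> u _; rewrite {1}rE; ring.
rewrite big_split -mulr_sumr /=.
have -> : \sum_u (u \in X)%:R * nu u = vol_mu nu X.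
  rewrite [RHS]big_mkcond; apply: eq_bigr => u _.
  by case: (u \in X); rewrite ?mul1r ?mul0r.
(* Edge by edge, the summand for [r] is [r m] times that for the indicator of [X] plus that for
   [r']; this is exact because [r'] is nonnegative and vanishes outside [X]. *)
rewrite (@eq_edge_sum _ _ _ _ _ (fun u v =>
    r m * (((u \in X) && (v \in X))%:R * a u v + ((u \in X) (+) (v \in X))%:R * w u v)
    + (Num.min (r' u) (r' v) * a u v + `|r' u - r' v| * w u v))).
  rewrite edge_sumD edge_sumZ edge_sum_indicator //.
  rewrite lerD ?ler_wpM2l // IH //.
  (* The support strictly shrinks: [m] is in [X] but [r' m = 0]. *)
  rewrite -ltnS; apply: leq_trans le_n; rewrite ltnS.
  apply: proper_card; apply/properP; split.
    by apply/fintype.subsetP => u; rewrite inE; apply: contraR => /r'out ->.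
  by exists m => //; rewrite inE negbK /r' (mX : m \in X) mul1r subrr.
clearbody r' => u v _; rewrite (rE u) (rE v).
have [uX|uX] := boolP (u \in X); have [vX|vX] := boolP (v \in X).
- rewrite !mul1r -addr_minr mul0r.
  have -> : r m + r' u - (r m + r' v) = r' u - r' v by ring.
  by rewrite /= addr0 mulrDl addrA.
- rewrite (r'out v) //= !mul1r !mul0r !addr0 !subr0 !(min_r (addr_ge0 _ _)) ?(min_r (r'0 _)) //.
  by rewrite !ger0_norm ?addr_ge0 //; ring.
- rewrite (r'out u) //= !mul1r !mul0r !addr0 !(min_l (addr_ge0 _ _)) ?(min_l (r'0 _)) //.
  by rewrite !sub0r !normrN !ger0_norm ?addr_ge0 //; ring.
- by rewrite (r'out u) // (r'out v) //= !mul0r !addr0 !subrr normr0 minxx; ring.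
Qed.

(* Averaging over the [N] rotations turns the rounded angle difference into the
   true one, up to one rounding step. *)
Lemma sum_rounded_edge_le (R : realType) (k N : nat) (p q a b : R) (z : R[i]) :
  (0 < k)%N -> (0 < N)%N -> 0 <= p -> 0 <= q -> rootsS1 k z ->
  \sum_(j < N) (Num.min p q *
      cmod (rounded_root k N (angle_floor k N a) j -
            z * rounded_root k N (angle_floor k N b) j) + `|p - q|) <=
  3 * cmod (p%:C * expi a - z * (q%:C * expi b)) * N%:R +
    Num.min p q * (2 * pi / k%:R).
Proof.
move=> k0 N0 p0 q0 [i _ ->]; have pi0 := @pi_gt0 R.
have kR : 0 < k%:R :> R by rewrite ltr0n.
have NR : 0 < N%:R :> R by rewrite ltr0n.
(* Among the angles of [z * expi b], take [c] within [pi] of [a], as [min_angle_le_cmod_polar]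
   requires. It differs from [b] by [t] steps of [2 pi / k], so rounding respects it. *)
have [m] := nearest_angle R a (b + 2 * pi * i%:R / k%:R).
pose t : int := i%:Z + m * k%:Z.
set c := (X in `|a - X|) => ac.
have cE : c = b + 2 * pi * t%:~R / k%:R.
  by rewrite /c /t intrD intrM; field; rewrite gt_eqF.
have ztE : expi (2 * pi * i%:R / k%:R) = expi (2 * pi * t%:~R / k%:R) :> R[i].
  have -> : 2 * pi * t%:~R / k%:R = 2 * pi * i%:R / k%:R + 2 * pi * m%:~R :> R.
    by rewrite /t intrD intrM; field; rewrite gt_eqF.
  by rewrite expiD expi_int mulr1.
have bE : expi (2 * pi * i%:R / k%:R) * (q%:C * expi b) = q%:C * expi c.
  by rewrite ztE cE expiD; ring.
rewrite bE ztE.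
under eq_bigr => j _ do rewrite -rounded_root_shift // -angle_floor_shift // -cE.
set n := angle_floor k N a; set n' := angle_floor k N c.
set P := Num.min p q; have P0 : 0 <= P by rewrite le_min p0.
rewrite [leLHS](_ : _ =
    P * (\sum_(j < N) cmod (rounded_root k N n j - rounded_root k N n' j))
    + `|p - q| * N%:R); last first.
  by rewrite big_split -mulr_sumr sumr_const card_ord mulr_natr.
(* Taking floors costs less than one unit; this is the only source of the error term. *)
have nn' : `|n - n'|%:~R <= N%:R * k%:R / (2 * pi) * `|a - c| + 1 :> R.
  have h : `|N%:R * k%:R * a / (2 * pi) - N%:R * k%:R * c / (2 * pi)| =
      N%:R * k%:R / (2 * pi) * `|a - c| :> R.
    have -> : N%:R * k%:R * a / (2 * pi) - N%:R * k%:R * c / (2 * pi) =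
      N%:R * k%:R / (2 * pi) * (a - c) :> R by ring.
    by rewrite normrM ger0_norm // divr_ge0 ?mulr_ge0 // ltW.
  rewrite -h intr_norm intrB /n /n' /angle_floor.
  move: (_ / _) => x; move: (_ / _) => y.
  have /andP[] := floor_itv x; have /andP[] := floor_itv y; rewrite !intrD.
  move: (_%:~R) => fy h1 h2; move: (_%:~R) => fx h3 h4.
  have := ler_norm (x - y); have := ler_norm (- (x - y)); rewrite normrN => h5 h6.
  by rewrite ler_norml; apply/andP; split; lra.
have w0 : 0 <= 2 * pi / k%:R :> R by rewrite divr_ge0 ?mulr_ge0 // ltW.
have S : \sum_(j < N) cmod (rounded_root k N n j - rounded_root k N n' j) <=
    N%:R * `|a - c| + 2 * pi / k%:R.
  (* Each chord is at most its arc, and the arcs sum exactly by [sum_abs_divz_sub]. *)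
  apply: le_trans (_ : \sum_(j < N) 2 * pi / k%:R *
    (`|((n + j%:Z) %/ N%:Z)%Z - ((n' + j%:Z) %/ N%:Z)%Z|)%:~R <= _).
    apply: ler_sum => j _; apply: le_trans (cmod_expi_sub_le _ _ _) _.
    rewrite intr_norm intrB -[X in X * `|_|]ger0_norm // -normrM.
    rewrite le_eqVlt; apply/orP; left; apply/eqP; congr (`|_|); ring.
  rewrite -mulr_sumr -(rmorph_sum intr) /= sum_abs_divz_sub //.
  apply: le_trans (ler_wpM2l w0 nn') _.
  rewrite le_eqVlt; apply/orP; left; apply/eqP.
  move: (@pi R) (lt0r_neq0 pi0) (lt0r_neq0 kR) => c0 c0n0 kn0.
  by field; rewrite c0n0 kn0.
(* [A1] contributes 2 and [A2] contributes 1 to the constant 3. *)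
have A1 := min_angle_le_cmod_polar R p q a c p0 q0 ac.
have A2 := abs_sub_le_cmod_polar R p q a c p0 q0.
have := ler_wpM2l P0 S; rewrite mulrDr.
rewrite -/P in A1.
move: A1 A2; move: (cmod (_ - _)) => D A1 A2.
have := ler_wpM2r (ltW NR) A1; have := ler_wpM2r (ltW NR) A2.
move: (\sum_(j < N) _) => T; move=> h1 h2 h3; lra.
Qed.

(** * The Cheeger bound for a rounded function, and the limit in [N] *)

Lemma vol_le_cheeger (R : realType) (V : finType) (e : rel V) (w : V -> V -> R)
    (mu : V -> R) (k : nat) (s : V -> V -> R[i]) (tau : V -> R[i]) (X : {set V}) :
  (forall u, 0 < mu u) -> (0 < k)%N -> (forall u, rootsS1 k (tau u)) ->
  cheeger e w mu k s * vol_mu mu X <=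
    signed_variation e w s X tau + edge_boundary e w X.
Proof.
move=> mu0 k0 tauS; have [->|X0] := eqVneq X finset.set0.
  rewrite /vol_mu /signed_variation /edge_sum /edge_boundary.
  by rewrite !big_set0 !mulr0 addr0.
have [u uX] := finset.set0Pn _ X0.
have V0 : (0 < #|V|)%N by apply/card_gt0P; exists u.
have [Y [_ -> Ymin]] := cheeger_min e w mu k s V0.
have volX : 0 < vol_mu mu X.
  by rewrite /vol_mu (bigD1 u) //= ltr_pwDl // sumr_ge0 // => v _; exact: ltW.
apply: le_trans (ler_wpM2r (ltW volX) (Ymin X X0)) _.
rewrite divfK ?gt_eqF // lerD2r.
have [t [_ -> tmin]] := frustration_min e w s X k0.
exact: tmin.
Qed.

Theorem theorem3p9 (R : realType) (V : finType)
  (e : rel V) (e_sym : symmetric e) (e_irr : irreflexive e)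
  (w : V -> V -> R) (w_sym : forall u v, e u v -> w u v = w v u)
  (w_gt0 : forall u v, e u v -> 0 < w u v)
  (mu : V -> R) (mu_gt0 : forall u, 0 < mu u)
  (k : nat) (k_gt0 : (0 < k)%N)
  (s : V -> V -> R[i]) (s_sig : is_signature e k s)
  (h_gt0 : 0 < cheeger e w mu k s) (f : V -> R[i]) :
  \sum_(u : V) cmod (f u) * mu u <=
    3 / cheeger e w mu k s *
      edge_sum e [set: V]%SET (fun u v => w u v * cmod (f u - s u v * f v)).
Proof.
set h := cheeger e w mu k s in h_gt0 *.
have /choice[al alP] : forall u, exists a : R, f u = (cmod (f u))%:C * expi a.
  by move=> u; exact: polar_form.
pose r u := cmod (f u); have r0 u : 0 <= r u := cmod_ge0 _ _.
set D := edge_sum _ _ _; set S := \sum_(u : V) _.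
(* The total rounding error over all [N] rotations; it does not depend on [N]. *)
pose C := edge_sum e [set: V]%SET
  (fun u v => w u v * (Num.min (r u) (r v) * (2 * pi / k%:R))).
have C0 : 0 <= C.
  rewrite mulr_ge0 ?invr_ge0 // sumr_ge0 // => u _; rewrite sumr_ge0 // => v /andP[_ /w_gt0 w0].
  by rewrite mulr_ge0 ?(ltW w0) // mulr_ge0 ?le_min ?r0 // divr_ge0 ?mulr_ge0 ?pi_ge0.
have key N : (0 < N)%N -> h * S * N%:R <= 3 * D * N%:R + C.
  move=> N0.
  pose tau (j : 'I_N) u : R[i] := rounded_root k N (angle_floor k N (al u)) j.
  pose F (j : 'I_N) u v := Num.min (r u) (r v) * (w u v * cmod (tau j u - s u v * tau j v))
    + `|r u - r v| * w u v.
  have stepj j : h * S <= edge_sum e [set: V]%SET (F j).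
    (* The layer-cake inequality is applied to the measure [h * mu], for which [vol_le_cheeger] is
       its hypothesis. *)
    have -> : h * S = \sum_u r u * (h * mu u).
      by rewrite mulr_sumr; apply: eq_bigr => u _; rewrite mulrCA.
    apply: layer_cake => // X.
    rewrite /vol_mu -mulr_sumr; apply: vol_le_cheeger => // u.
    exact: rootsS1_int.
  apply: le_trans (_ : \sum_(j < N) edge_sum e [set: V]%SET (F j) <= _).
    apply: le_trans (ler_sum _ (fun j _ => stepj j)).
    by rewrite sumr_const card_ord mulr_natr.
  rewrite -edge_sum_sum [3 * D]mulrC -mulrA mulrC -edge_sumZ -edge_sumD.
  apply: edge_sum_le => u v euv.
  have := sum_rounded_edge_le R k N (r u) (r v) (al u) (al v) (s u v) k_gt0 N0
    (r0 u) (r0 v) (s_sig _ _ euv).1.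
  rewrite -!alP => H; have := ler_wpM2l (ltW (w_gt0 _ _ euv)) H.
  rewrite mulr_sumr => {}H.
  under eq_bigr => j _ do rewrite /F mulrCA [_ * w u v]mulrC -mulrDr.
  apply: le_trans H _; rewrite le_eqVlt; apply/orP; left; apply/eqP; ring.
have hS : h * S <= 3 * D.
  apply/ler_addgt0Pr => eps eps0.
  (* The error per rotation, [C / N.+1], drops below [eps]; the successor makes the count
     positive. *)
  have [N hN] : exists N : nat, C / eps < N%:R.
    by exists (Num.bound (C / eps)); apply: archi_boundP; rewrite divr_ge0 // ltW.
  have N1 : 0 < N.+1%:R :> R by rewrite ltr0n.
  rewrite -(ler_pM2r N1); apply: le_trans (key N.+1 isT) _.
  rewrite [leRHS]mulrDl lerD2l mulrC -ler_pdivrMr //.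
  by apply: ltW; apply: lt_trans hN _; rewrite ltr_nat.
by rewrite mulrAC ler_pdivlMr // mulrC.
Qed.
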